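(* Let $\Delta v>0$, $T>0$, $N_t\in\mathbb{N}^*$, $\Delta t=T/N_t$. Let $\varphi_{\mathrm{in}}:\mathbb{R}\times\mathbb{R}\to\mathbb{R}$, let $\mu_{\mathrm{in}}(x)=\min_{j\in\mathbb{Z}}\varphi_{\mathrm{in}}(x-\Delta t\,v_j,v_j)$, and assume there exist $M>0$ and $L\ge0$ such that (a) $\left|\varphi_{\mathrm{in}}(x,v)-\frac{v^2}{2}\right|\le M$ for all $(x,v)\in\mathbb{R}^2$; (b) $\left|\mu_{\mathrm{in}}(x)+\varepsilon\ln(c^\varepsilon_{\Delta v})\right|\le M$ for all $x\in\mathbb{R}$ and all $\varepsilon\in(0,1]$; (c) for all $v\in\mathbb{R}$, $x\mapsto\varphi_{\mathrm{in}}(x,v)-\frac{v^2}{2}$ is $L$-Lipschitz. Then, for all $n\in\{1,\dots,N_t\}$ and all $\varepsilon>0$, the solution of the semi-discrete scheme $(\mathcal{S}^\varepsilon_{\Delta t,\Delta v})$ (defined in the context) satisfies the same bounds: for all $x\in\mathbb{R}$ and $j\in\mathbb{Z}$, $$\left|\varphi_j^{\varepsilon,n}(x)-\frac{v_j^2}{2}\right|\le M,\qquad \left|\mu^{\varepsilon,n}(x)+\varepsilon\ln(c^\varepsilon_{\Delta v})\right|\le M,$$ and, for all $j\in\mathbb{Z}$, the function $x\mapsto\varphi_j^{\varepsilon,n}(x)-\frac{v_j^2}{2}$ is $L$-Lipschitz.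
   Context: Discrete velocities $v_j=j\Delta v$, $j\in\mathbb{Z}$. $\langle u\rangle_{\Delta v}=\sum_{j\in\mathbb{Z}}u_j\Delta v$ and $c^\varepsilon_{\Delta v}=\sum_{j\in\mathbb{Z}}e^{-v_j^2/(2\varepsilon)}\Delta v$. Scheme $(\mathcal{S}^\varepsilon_{\Delta t,\Delta v})$: for $x\in\mathbb{R}$, $j\in\mathbb{Z}$, $0\le n\le N_t-1$, with $$m^{\varepsilon,n}(x)=\min_{j\in\mathbb{Z}}\varphi_j^{\varepsilon,n}(x-\Delta t\,v_j),\qquad M_j^{\varepsilon,n}(x)=\min\left\{\varphi_j^{\varepsilon,n}(x-\Delta t\,v_j)+\Delta t,\ \frac{v_j^2}{2}+\mu^{\varepsilon,n+1}(x)\right\},$$ $$\mu^{\varepsilon,n+1}(x)=m^{\varepsilon,n}(x)-\varepsilon\ln\left(\left\langle e^{-[\varphi_j^{\varepsilon,n}(x-\Delta t v_j)-m^{\varepsilon,n}(x)]/\varepsilon}\right\rangle_{\Delta v}\right),$$ $$\varphi_j^{\varepsilon,n+1}(x)=M_j^{\varepsilon,n}(x)-\varepsilon\ln\left(c^\varepsilon_{\Delta v}e^{-[\varphi_j^{\varepsilon,n}(x-\Delta t v_j)+\Delta t-M_j^{\varepsilon,n}(x)]/\varepsilon}+(1-e^{-\Delta t/\varepsilon})e^{-[\frac{v_j^2}{2}+\mu^{\varepsilon,n+1}(x)-M_j^{\varepsilon,n}(x)]/\varepsilon}\right)+\varepsilon\ln(c^\varepsilon_{\Delta v}),$$ initialized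 with $\varphi_j^{\varepsilon,0}(x)=\varphi_{\mathrm{in}}(x,v_j)$ and $\mu^{\varepsilon,0}(x)=\mu_{\mathrm{in}}(x)$. *)

(* Defs.v *)
From HB Require Import structures.
From mathcomp Require Import all_boot all_order all_algebra.
From mathcomp Require Import all_classical all_reals all_analysis.

Set Implicit Arguments.
Unset Strict Implicit.
Unset Printing Implicit Defensive.

Import Order.TTheory GRing.Theory Num.Theory.
Import numFieldNormedType.Exports.

Local Open Scope classical_set_scope.
Local Open Scope ring_scope.

(* v_j = j Delta v *)
Definition vel (R : realType) (dv : R) (j : int) : R := j%:~R * dv.

(* <u>_{Delta v} = sum_{j in Z} u_j Delta v, as the sum of an absolutely
   summable family; [\esum] is only meaningful for nonnegative terms, hence the
   splitting into positive and negative parts. If one of the two parts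
   diverges, [fine] replaces it by 0. *)
Definition bracket (R : realType) (dv : R) (u : int -> R) : R :=
  let w := fun j => u j * dv in
  fine (\esum_(j in [set: int]) (w^\+ j)%:E) -
  fine (\esum_(j in [set: int]) (w^\- j)%:E).

(* c^eps_{Delta v} *)
Definition cdv (R : realType) (eps dv : R) : R :=
  bracket dv (fun j => expR (- (vel dv j ^+ 2 / (2 * eps)))).

(* min_{j in Z} f_j as an attained minimum (with value 0 if the minimum does
   not exist), not an infimum. *)
Definition minZ (R : realType) (f : int -> R) : R :=
  xget 0 (range f `&` lbound (range f)).

(* In the definitions below, [phi j x] stands for phi_j^{eps,n}(x). *)
Section Scheme.
Context (R : realType) (eps dt dv : R).
Implicit Types phi : int -> R -> R.

Definition transported phi (j : int) (x : R) : R := phi j (x - dt * vel dv j).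

(* m^{eps,n} *)
Definition scheme_min phi (x : R) : R := minZ (fun j => transported phi j x).

(* mu^{eps,n+1} *)
Definition scheme_mu phi (x : R) : R :=
  scheme_min phi x - eps *
    ln (bracket dv (fun j =>
      expR (- ((transported phi j x - scheme_min phi x) / eps)))).

(* M_j^{eps,n} *)
Definition scheme_M phi (j : int) (x : R) : R :=
  Num.min (transported phi j x + dt) (vel dv j ^+ 2 / 2 + scheme_mu phi x).

(* phi_j^{eps,n+1} *)
Definition scheme_phi phi (j : int) (x : R) : R :=
  scheme_M phi j x
  - eps * ln (cdv eps dv
                * expR (- ((transported phi j x + dt - scheme_M phi j x) / eps))
              + (1 - expR (- (dt / eps)))
                * expR (- ((vel dv j ^+ 2 / 2 + scheme_mu phi x
                            - scheme_M phi j x) / eps)))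
  + eps * ln (cdv eps dv).

Fixpoint sol_phi (phi_in : R -> R -> R) (n : nat) : int -> R -> R :=
  if n is n'.+1 then scheme_phi (sol_phi phi_in n')
  else fun j x => phi_in x (vel dv j).

Definition sol_mu (phi_in : R -> R -> R) (mu_in : R -> R) (n : nat) : R -> R :=
  if n is n'.+1 then scheme_mu (sol_phi phi_in n') else mu_in.

End Scheme.

(* Main.v *)
Require Import Defs.
From HB Require Import structures.
From mathcomp Require Import all_boot all_order all_algebra.
From mathcomp Require Import lra zify ring.
From mathcomp Require Import all_classical all_reals all_analysis.

Set Implicit Arguments.
Unset Strict Implicit.
Unset Printing Implicit Defensive.

Import Order.TTheory GRing.Theory Num.Theory.
Import numFieldNormedType.Exports.

Local Open Scope classical_set_scope.
Local Open Scope ring_scope.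

(** Undoing the logarithms explains the scheme. The numbers
    [scheme_min] and [scheme_M] are normalisations of log-sum-exp expressions,
    and cancel: with
    [F g = - eps ln <exp (- g_j / eps)>] one has [mu' = F (t)], where [t] is the
    transported [phi], and dividing by [cdv] inside the logarithm gives
    [phi'_j - v_j^2/2
       = - eps ln (q exp (- (t_j - v_j^2/2) / eps)
                   + (1 - q) exp (- (mu' + eps ln cdv) / eps))]
    with [q = exp (- dt / eps)] and [0 < q < 1]: a soft minimum of
    [t_j - v_j^2/2] and [mu' + eps ln cdv]. Since [F] maps the kinetic energy
    [v_j^2/2] to [- eps ln cdv], also [mu' + eps ln cdv = F t - F (v^2/2)].

    Both [F] and the soft minimum are nonexpansive for the sup norm: changing
    the arguments by at most [K] multiplies what stands inside the logarithm by
    at most [exp (K / eps)] ([free_energy_dist], [softmin2_dist]). Comparing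
    with the kinetic energy, respectively with the pair (0, 0), propagates the
    bound by [M]; comparing the values at two points x and y propagates the
    Lipschitz constant [L], because transport shifts both points by the same
    vector. Induction on the time step concludes.

    The analysis left is the summability over the integers of the weights
    [exp (- g_j / eps)] for [g] at bounded distance from the kinetic energy,
    so that [bracket] is a genuine positive sum; it follows from a comparison
    with a geometric series ([summable_gibbs]). *)

(** * Sums over the integers *)

Lemma esumZl (R : realType) (I : choiceType) (D : set I) (f : I -> \bar R)
    (k : R) :
  0 < k -> (forall i, 0 <= f i)%E ->
  (\esum_(i in D) (k%:E * f i) = k%:E * \esum_(i in D) f i)%E.
Proof.
move=> k0 f0; rewrite /esum -ereal_sup_pZl//; congr ereal_sup.
rewrite image_comp; apply: eq_imagel => A _ /=.
by rewrite ge0_mule_fsumr.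
Qed.

Lemma ge0_summableE (R : realType) (I : choiceType) (f : I -> R) :
  (forall i, 0 <= f i) ->
  summable [set: I] (EFin \o f)
  = (\esum_(i in [set: I]) (f i)%:E \is a fin_num).
Proof.
by move=> f0; rewrite summableE; under eq_esum do rewrite /= ger0_norm//.
Qed.

Lemma summable_le (R : realType) (I : choiceType) (f g : I -> R) (k : R) :
  0 < k -> (forall i, 0 <= f i <= k * g i) ->
  summable [set: I] (EFin \o g) -> summable [set: I] (EFin \o f).
Proof.
move=> k0 fg gfin; rewrite /summable.
apply: (@le_lt_trans _ _ (\esum_(i in [set: I]) (k%:E * `|(g i)%:E|))%E).
  apply: le_esum => i _ /=; have /andP[fi0 fi] := fg i.
  rewrite -EFinM lee_fin ger0_norm// (le_trans fi)//.
  by rewrite ler_wpM2l ?ler_norm// ltW.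
rewrite esumZl//; have : (\esum_(i in [set: I]) `|(g i)%:E| \is a fin_num)%E.
  by rewrite -(@summableE _ _ setT (EFin \o g)).
by move/fineK <-; rewrite -EFinM ltry.
Qed.

Lemma summable_geometric_int (R : realType) (r : R) : 0 <= r < 1 ->
  summable [set: int] (EFin \o (fun j : int => r ^+ `|j|%N)).
Proof.
move=> /andP[r0 r1]; rewrite /summable (esumID (range Posz))//= !setTI.
have -> : ~` range Posz = range Negz.
  apply/seteqP; split => [[n|n] /= h|_ [n _ <-] /= [m _]] //; last by exists n.
  by exfalso; apply: h; exists n.
rewrite !esum_image//; try by move=> x y _ _ [].
have gfin : (\esum_(i in [set: nat]) (r ^+ i)%:E < +oo)%E.
  rewrite -nneseries_esumT; last by move=> n; rewrite lee_fin exprn_ge0.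
  have cr : cvgn (series (geometric 1 r)).
    by apply: is_cvg_geometric_series; rewrite ger0_norm.
  rewrite (_ : (fun n => _) = EFin \o series (geometric 1 r)).
    by rewrite EFin_lim// ltry.
  apply/funext => n /=; rewrite sumEFin; congr (_%:E).
  by apply: eq_bigr => i _; rewrite /= mul1r.
apply: lte_add_pinfty; apply: le_lt_trans gfin; apply: le_esum => n _ /=.
  by rewrite lee_fin ger0_norm// exprn_ge0.
(* [Negz n] is [- n.+1], hence the extra factor [r <= 1]. *)
by rewrite lee_fin ger0_norm ?exprn_ge0// exprS ler_piMl ?exprn_ge0// ltW.
Qed.

(** Since [`|j| <= j ^ 2], the Gaussian is below the geometric family of ratio
    [exp (- a)]. *)
Lemma summable_gaussian_int (R : realType) (a : R) : 0 < a ->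
  summable [set: int] (EFin \o (fun j : int => expR (- (a * j%:~R ^+ 2)))).
Proof.
move=> a0; have r01 : 0 <= expR (- a) < 1.
  by rewrite expR_ge0 expR_lt1 oppr_lt0.
apply: summable_le ltr01 _ (summable_geometric_int r01) => j.
rewrite expR_ge0 mul1r -expRM_natl ler_expR mulrN lerN2 mulrC ler_pM2l//.
rewrite natr_absz -[_ ^+ 2]ger0_norm ?sqr_ge0// normrX -intr_norm.
rewrite -rmorphXn/= ler_int.
by move: (normr_ge0 j); move: `|j| => k; nia.
Qed.

(** * The bracket of a nonnegative summable family *)

Lemma bracketE (R : realType) (dv : R) (u : int -> R) :
  0 < dv -> (forall j, 0 <= u j) ->
  summable [set: int] (EFin \o u) ->
  bracket dv u = dv * fine (\esum_(j in [set: int]) (u j)%:E).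
Proof.
move=> dv0 u0 us.
have w0 (j : int) : 0 <= u j * dv by rewrite mulr_ge0// ltW.
rewrite /bracket.
have -> : \esum_(j in [set: int]) ((fun j => u j * dv)^\- j)%:E = 0%E.
  by apply: esum1 => j _; rewrite /funrneg max_r// oppr_le0.
rewrite subr0.
have -> : \esum_(j in [set: int]) ((fun j => u j * dv)^\+ j)%:E
    = (dv%:E * \esum_(j in [set: int]) (u j)%:E)%E.
  rewrite -esumZl//; apply: eq_esum => j _.
  by rewrite /funrpos max_l// -EFinM mulrC.
by rewrite fineM//; rewrite ge0_summableE in us.
Qed.
Lemma bracket_gt0 (R : realType) (dv : R) (u : int -> R) :
  0 < dv -> (forall j, 0 < u j) -> summable [set: int] (EFin \o u) ->
  0 < bracket dv u.
Proof.
move=> dv0 u0 us; rewrite bracketE//; last by move=> j; rewrite ltW.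
rewrite mulr_gt0// (lt_le_trans (u0 0))// -lee_fin fineK.
  apply: esum_ge; exists [set 0]; first by split.
  by rewrite fsbig_set1.
by rewrite ge0_summableE in us => // j; rewrite ltW.
Qed.

Lemma bracket_le (R : realType) (dv : R) (u w : int -> R) :
  0 < dv -> (forall j, 0 <= u j <= w j) -> summable [set: int] (EFin \o w) ->
  bracket dv u <= bracket dv w.
Proof.
move=> dv0 uw ws.
have u0 j : 0 <= u j by have /andP[] := uw j.
have w0 j : 0 <= w j by have /andP[_] := uw j; exact: le_trans.
have us : summable [set: int] (EFin \o u).
  by apply: summable_le ltr01 _ ws => j; rewrite mul1r.
rewrite !bracketE// ler_pM2l// fine_le//.
- by rewrite -ge0_summableE.
- by rewrite -ge0_summableE.
- by apply: le_esum => j _; rewrite lee_fin; have /andP[] := uw j.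
Qed.

Lemma bracketZ (R : realType) (dv k : R) (u : int -> R) :
  0 < dv -> 0 < k -> (forall j, 0 <= u j) ->
  summable [set: int] (EFin \o u) ->
  bracket dv (fun j => k * u j) = k * bracket dv u.
Proof.
move=> dv0 k0 u0 us.
have ku0 j : 0 <= k * u j by rewrite mulr_ge0// ltW.
have kus : summable [set: int] (EFin \o (fun j => k * u j)).
  by apply: summable_le k0 _ us => j; rewrite ku0 lexx.
rewrite !bracketE//; under eq_esum do rewrite EFinM.
rewrite esumZl// fineM//; first by rewrite mulrCA.
by rewrite -ge0_summableE.
Qed.

(** * Nonexpansiveness of the free energy and of the soft minimum *)

Lemma eps_ln_le (R : realType) (eps K s t : R) :
  0 < eps -> 0 < s -> 0 < t -> s <= expR (K / eps) * t ->
  eps * ln s <= K + eps * ln t.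
Proof.
move=> eps0 s0 t0 st.
have : ln s <= K / eps + ln t.
  rewrite -{1}(expRK (K / eps)) -lnM ?posrE ?expR_gt0//.
  by rewrite ler_ln ?posrE ?mulr_gt0 ?expR_gt0.
by rewrite -(ler_pM2l eps0) mulrDr mulrCA divff ?gt_eqF// mulr1.
Qed.

(** The common source of nonexpansiveness: [- eps ln] turns a multiplicative
    comparison up to [exp (K / eps)] into an additive one up to [K]. *)
Lemma eps_ln_dist (R : realType) (eps K s t : R) :
  0 < eps -> 0 < s -> 0 < t ->
  s <= expR (K / eps) * t -> t <= expR (K / eps) * s ->
  `|- (eps * ln s) - - (eps * ln t)| <= K.
Proof.
move=> eps0 s0 t0 /(eps_ln_le eps0 s0 t0) st /(eps_ln_le eps0 t0 s0) ts.
by rewrite ler_norml; apply/andP; split; lra.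
Qed.

Lemma gibbs_le (R : realType) (eps K a b : R) : 0 < eps -> `|a - b| <= K ->
  expR (- (a / eps)) <= expR (K / eps) * expR (- (b / eps)).
Proof.
move=> eps0; rewrite ler_norml => /andP[lo hi].
rewrite -expRD ler_expR -mulNr -mulNr -mulrDl ler_pM2r ?invr_gt0//; lra.
Qed.

(** Up to the factor [- eps], the logarithm of the partition function of the
    energies [g j] at temperature [eps]: a smooth substitute for the minimum of [g]. *)
Definition free_energy (R : realType) (eps dv : R) (g : int -> R) : R :=
  - (eps * ln (bracket dv (fun j => expR (- (g j / eps))))).

(** The Gibbs weights are dominated by [exp (K / eps)] times the Gaussian of the
    kinetic energy. *)
Lemma summable_gibbs (R : realType) (eps dv K : R) (g : int -> R) :
  0 < eps -> 0 < dv -> (forall j, `|g j - vel dv j ^+ 2 / 2| <= K) ->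
  summable [set: int] (EFin \o (fun j => expR (- (g j / eps)))).
Proof.
move=> eps0 dv0 gK.
have a0 : 0 < dv ^+ 2 / 2 / eps by rewrite !divr_gt0// exprn_gt0.
apply: summable_le (expR_gt0 (K / eps)) _ (summable_gaussian_int a0) => j.
rewrite expR_ge0/=.
have -> : dv ^+ 2 / 2 / eps * j%:~R ^+ 2 = vel dv j ^+ 2 / 2 / eps.
  by rewrite /vel; ring.
exact: gibbs_le.
Qed.

Lemma free_energy_dist (R : realType) (eps dv K : R) (f g : int -> R) :
  0 < eps -> 0 < dv -> (forall j, `|f j - g j| <= K) ->
  summable [set: int] (EFin \o (fun j => expR (- (f j / eps)))) ->
  summable [set: int] (EFin \o (fun j => expR (- (g j / eps)))) ->
  `|free_energy eps dv f - free_energy eps dv g| <= K.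
Proof.
move=> eps0 dv0 fg fs gs.
have bpos h : summable [set: int] (EFin \o (fun j => expR (- (h j / eps)))) ->
    0 < bracket dv (fun j => expR (- (h j / eps))).
  by move=> hs; apply: bracket_gt0 => // j; exact: expR_gt0.
have ble h h' : (forall j, `|h j - h' j| <= K) ->
    summable [set: int] (EFin \o (fun j => expR (- (h' j / eps)))) ->
    bracket dv (fun j => expR (- (h j / eps)))
      <= expR (K / eps) * bracket dv (fun j => expR (- (h' j / eps))).
  move=> hh' hs; rewrite -bracketZ ?expR_gt0//.
  apply: bracket_le => // [j|]; first by rewrite expR_ge0 gibbs_le.
  apply: summable_le (expR_gt0 (K / eps)) _ hs => j.
  by rewrite mulr_ge0 ?expR_ge0//=.
apply: eps_ln_dist; rewrite ?bpos ?ble// => j.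
by rewrite distrC.
Qed.

(** This makes [mu + eps ln cdv] a difference of two free energies, hence
    accessible to [free_energy_dist]. *)
Lemma free_energy_kinetic (R : realType) (eps dv : R) :
  free_energy eps dv (fun j => vel dv j ^+ 2 / 2) = - (eps * ln (cdv eps dv)).
Proof.
rewrite /free_energy /cdv; congr (- (_ * ln (bracket _ _))).
by apply/funext => j; rewrite invfM mulrA.
Qed.

Definition softmin2 (R : realType) (eps q a b : R) : R :=
  - (eps * ln (q * expR (- (a / eps)) + (1 - q) * expR (- (b / eps)))).

Lemma softmin2_dist (R : realType) (eps q K a b a' b' : R) :
  0 < eps -> 0 < q < 1 -> `|a - a'| <= K -> `|b - b'| <= K ->
  `|softmin2 eps q a b - softmin2 eps q a' b'| <= K.
Proof.
move=> eps0 /andP[q0 q1] aa' bb'.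
have r0 : 0 < 1 - q by rewrite subr_gt0.
have pos (c d : R) :
    0 < q * expR (- (c / eps)) + (1 - q) * expR (- (d / eps)).
  by rewrite addr_gt0// mulr_gt0// expR_gt0.
have le (c d c' d' : R) : `|c - c'| <= K -> `|d - d'| <= K ->
    q * expR (- (c / eps)) + (1 - q) * expR (- (d / eps)) <=
    expR (K / eps) * (q * expR (- (c' / eps)) + (1 - q) * expR (- (d' / eps))).
  move=> /(gibbs_le eps0) cc' /(gibbs_le eps0) dd'.
  rewrite mulrDr !(mulrCA (expR (K / eps))).
  by rewrite lerD// ler_pM2l.
by apply: eps_ln_dist; rewrite ?pos ?le// distrC.
Qed.

Lemma softmin20 (R : realType) (eps q : R) : softmin2 eps q 0 0 = 0.
Proof.
by rewrite /softmin2 mul0r oppr0 expR0 !mulr1 addrC subrK ln1 mulr0 oppr0.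
Qed.

Lemma softmin2_bound (R : realType) (eps q K a b : R) :
  0 < eps -> 0 < q < 1 -> `|a| <= K -> `|b| <= K -> `|softmin2 eps q a b| <= K.
Proof.
move=> eps0 q01 aK bK; rewrite -[softmin2 _ _ _ _]subr0 -(softmin20 eps q).
by apply: softmin2_dist; rewrite ?subr0.
Qed.

Lemma cdv_gt0 (R : realType) (eps dv : R) : 0 < eps -> 0 < dv -> 0 < cdv eps dv.
Proof.
move=> eps0 dv0; apply: bracket_gt0 => // [j|]; first exact: expR_gt0.
have h j : `|vel dv j ^+ 2 / 2 - vel dv j ^+ 2 / 2| <= 0.
  by rewrite subrr normr0.
have := summable_gibbs eps0 dv0 h.
rewrite (_ : (fun j => _) = fun j => expR (- (vel dv j ^+ 2 / (2 * eps))))//.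
by apply/funext => j; rewrite invfM mulrA.
Qed.

(** * One step of the scheme *)

(** Subtracting a constant from the energies lowers the free energy by that
    constant, so [scheme_min], added back outside the logarithm, cancels. *)
Lemma scheme_mu_free_energy (R : realType) (eps dt dv : R)
    (phi : int -> R -> R) (x : R) :
  0 < eps -> 0 < dv ->
  summable [set: int]
    (EFin \o (fun j => expR (- (transported dt dv phi j x / eps)))) ->
  scheme_mu eps dt dv phi x
    = free_energy eps dv (fun j => transported dt dv phi j x).
Proof.
move=> eps0 dv0 ts; rewrite /scheme_mu /free_energy.
set m := scheme_min _ _ _ _.
rewrite (_ : (fun j => _) = fun j =>
    expR (m / eps) * expR (- (transported dt dv phi j x / eps))); last first.
  by apply/funext => j; rewrite -expRD; congr expR; ring.
rewrite bracketZ ?expR_gt0//.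
rewrite lnM ?posrE ?expR_gt0 ?bracket_gt0//; last by move=> j; exact: expR_gt0.
by rewrite expRK mulrDr mulrCA divff ?gt_eqF// mulr1 opprD addNKr.
Qed.

(** The factor [cdv * exp ((m - v) / eps)], with [m] the normalisation
    [scheme_M] and [v] the kinetic energy, can be taken out of the logarithm of
    the scheme; its own logarithm cancels [m] and [eps ln cdv], and what is left
    inside is the convex combination of [softmin2]. *)
Lemma scheme_phi_softmin2 (R : realType) (eps dt dv : R) (phi : int -> R -> R)
    (j : int) (x : R) :
  0 < eps -> 0 < dt -> 0 < dv ->
  scheme_phi eps dt dv phi j x - vel dv j ^+ 2 / 2 =
  softmin2 eps (expR (- (dt / eps)))
    (transported dt dv phi j x - vel dv j ^+ 2 / 2)
    (scheme_mu eps dt dv phi x + eps * ln (cdv eps dv)).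
Proof.
move=> eps0 dt0 dv0; rewrite /scheme_phi.
have c0 := cdv_gt0 eps0 dv0.
have epsN0 : eps != 0 by rewrite gt_eqF.
move: (cdv eps dv) c0 => c c0.
move: (scheme_M _ _ _ _ _ _) => m.
move: (scheme_mu _ _ _ _ _) (transported _ _ _ _ _) => mu t.
set v := vel dv j ^+ 2 / 2; set q := expR (- (dt / eps)).
have q1 : 0 < 1 - q by rewrite subr_gt0 expR_lt1 oppr_lt0 divr_gt0.
rewrite /softmin2; set S := (X in _ = - (eps * ln X)).
have S0 : 0 < S by rewrite addr_gt0// mulr_gt0// expR_gt0.
have -> : c * expR (- ((t + dt - m) / eps))
    + (1 - q) * expR (- ((v + mu - m) / eps)) = c * expR ((m - v) / eps) * S.
  have -> : expR (- ((t + dt - m) / eps))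
      = expR ((m - v) / eps) * (q * expR (- ((t - v) / eps))).
    by rewrite -!expRD; congr expR; ring.
  have -> : expR (- ((v + mu - m) / eps))
      = c * expR ((m - v) / eps) * expR (- ((mu + eps * ln c) / eps)).
    rewrite -[X in X * _ * _](lnK (x := c)) ?posrE// -!expRD; congr expR.
    by field.
  by rewrite /S; ring.
by rewrite !lnM ?posrE ?mulr_gt0 ?expR_gt0// expRK; field.
Qed.

Lemma lipschitzP (R : realType) (L : R) (f : R -> R) :
  L.-lipschitz f <-> forall x y, `|f x - f y| <= L * `|x - y|.
Proof.
split=> [Lf x y|Lf]; first by have := Lf (x, y); apply; split.
by move=> [x y] _; exact: Lf.
Qed.

Lemma gibbs_weight01 (R : realType) (eps dt : R) :
  0 < eps -> 0 < dt -> 0 < expR (- (dt / eps)) < 1.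
Proof. by move=> eps0 dt0; rewrite expR_gt0 expR_lt1 oppr_lt0 divr_gt0. Qed.

Lemma summable_transported (R : realType) (eps dt dv M : R)
    (phi : int -> R -> R) (x : R) :
  0 < eps -> 0 < dv -> (forall x j, `|phi j x - vel dv j ^+ 2 / 2| <= M) ->
  summable [set: int]
    (EFin \o (fun j => expR (- (transported dt dv phi j x / eps)))).
Proof.
move=> eps0 dv0 phiM; apply: (summable_gibbs (dv := dv) (K := M)) => // j.
exact: phiM.
Qed.

Lemma scheme_mu_bound (R : realType) (eps dt dv M : R) (phi : int -> R -> R) :
  0 < eps -> 0 < dv -> (forall x j, `|phi j x - vel dv j ^+ 2 / 2| <= M) ->
  forall x, `|scheme_mu eps dt dv phi x + eps * ln (cdv eps dv)| <= M.
Proof.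
move=> eps0 dv0 phiM x; have ts := summable_transported dt x eps0 dv0 phiM.
rewrite scheme_mu_free_energy// -[eps * _]opprK -free_energy_kinetic.
apply: free_energy_dist => // [j|]; first exact: phiM.
by apply: (summable_gibbs (dv := dv) (K := 0)) => // j; rewrite subrr normr0.
Qed.

Lemma scheme_phi_bound (R : realType) (eps dt dv M : R) (phi : int -> R -> R) :
  0 < eps -> 0 < dt -> 0 < dv ->
  (forall x j, `|phi j x - vel dv j ^+ 2 / 2| <= M) ->
  forall x j, `|scheme_phi eps dt dv phi j x - vel dv j ^+ 2 / 2| <= M.
Proof.
move=> eps0 dt0 dv0 phiM x j; rewrite scheme_phi_softmin2//.
apply: softmin2_bound => //; first exact: gibbs_weight01.
  exact: phiM.
exact: scheme_mu_bound.
Qed.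

Lemma scheme_phi_lipschitz (R : realType) (eps dt dv M L : R)
    (phi : int -> R -> R) :
  0 < eps -> 0 < dt -> 0 < dv ->
  (forall x j, `|phi j x - vel dv j ^+ 2 / 2| <= M) ->
  (forall j, L.-lipschitz (fun x => phi j x - vel dv j ^+ 2 / 2)) ->
  forall j,
    L.-lipschitz (fun x => scheme_phi eps dt dv phi j x - vel dv j ^+ 2 / 2).
Proof.
move=> eps0 dt0 dv0 phiM phiL j; apply/lipschitzP => x y.
have tL i : `|transported dt dv phi i x - transported dt dv phi i y|
    <= L * `|x - y|.
  have /lipschitzP/(_ (x - dt * vel dv i) (y - dt * vel dv i)) := phiL i.
  by rewrite [in leRHS]opprB [in leRHS]addrA subrK opprB addrA subrK.
have ts z := summable_transported dt z eps0 dv0 phiM.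
rewrite [X in `|X - _|]scheme_phi_softmin2//.
rewrite [X in `|_ - X|]scheme_phi_softmin2//.
apply: softmin2_dist => //; first exact: gibbs_weight01.
  by rewrite opprB addrA subrK.
rewrite (scheme_mu_free_energy eps0 dv0 (ts x)).
rewrite (scheme_mu_free_energy eps0 dv0 (ts y)).
rewrite opprD addrACA subrr addr0.
exact: free_energy_dist.
Qed.

Theorem corollary3p3 (R : realType) (dv T : R) (Nt : nat) (dt : R)
    (phi_in : R -> R -> R) (mu_in : R -> R) (M L : R)
    (hdv : 0 < dv) (hT : 0 < T) (hNt : (0 < Nt)%N) (hdt : dt = T / Nt%:R)
    (hmu_in : forall x : R,
       mu_in x = minZ (fun j : int => phi_in (x - dt * vel dv j) (vel dv j)))
    (hM : 0 < M) (hL : 0 <= L)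
    (ha : forall x v : R, `|phi_in x v - v ^+ 2 / 2| <= M)
    (hb : forall x eps : R, 0 < eps <= 1 ->
       `|mu_in x + eps * ln (cdv eps dv)| <= M)
    (hc : forall v : R, L.-lipschitz (fun x : R => phi_in x v - v ^+ 2 / 2)) :
  forall (n : nat) (eps : R), (1 <= n <= Nt)%N -> 0 < eps ->
    [/\ forall (x : R) (j : int),
          `|sol_phi eps dt dv phi_in n j x - vel dv j ^+ 2 / 2| <= M,
        forall x : R,
          `|sol_mu eps dt dv phi_in mu_in n x + eps * ln (cdv eps dv)| <= M
      & forall j : int,
          L.-lipschitz
            (fun x : R => sol_phi eps dt dv phi_in n j x - vel dv j ^+ 2 / 2)].
Proof.
have dt0 : 0 < dt by rewrite hdt divr_gt0// ltr0n.
move=> n eps /andP[n1 _] eps0.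
have inv k :
    (forall x j, `|sol_phi eps dt dv phi_in k j x - vel dv j ^+ 2 / 2| <= M)
    /\ forall j, L.-lipschitz
         (fun x => sol_phi eps dt dv phi_in k j x - vel dv j ^+ 2 / 2).
  elim: k => [|k [kM kL]]; first by split=> [x j|j]; [exact: ha|exact: hc].
  by split=> [x j|j]; [exact: scheme_phi_bound|exact: scheme_phi_lipschitz].
case: n n1 => // n _; have [nM nL] := inv n.+1.
by split=> // x; apply: scheme_mu_bound => // y j; exact: (inv n).1.
Qed.
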